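(* Let $\lambda\vdash n$ with $\lambda'=(s,r)$, $s\ge r\ge 1$, let $0\le\Delta<r$ and let $\sigma\in W_\lambda^\Delta$. Then there is a unique pair $(\pi,J)$ such that $\pi\in W_\lambda^0$, $J$ is a jump partition for $\pi$ of size $\Delta$ that is valid for $\pi$, and $\sigma=J(\pi)$.
   Context: For $\sigma\in S_n$, shape means Robinson–Schensted shape; $\lambda'$ is the conjugate of $\lambda$. $W_\lambda^\Delta$ is the set of permutations of shape $\lambda$ with exactly $\Delta$ more inversions than the minimum over permutations of shape $\lambda$; $W_\lambda^0$ is the set of minimal permutations. For $\lambda'=(s,r)$ the minimal permutations are exactly $(c_1,c_1-1,\dots,1,\,n,\dots,c_1+1)$ (one-line notation) with $(c_1,c_2)\in\{(s,r),(r,s)\}$, $n=s+r$. For such $\pi$: $s_t$ is the adjacent transposition $(t\ t{+}1)$; $\sigma\cdot s_t$ swaps the entries at positions $t,t+1$, and $s_t\cdot\sigma$ swaps the values $t,t+1$; products act successively (left to right for right multiplication, rightmost first for left multiplication). An inner (resp. outer) jump partition is an integer partition $\mu$ (resp. $\nu$), possibly empty, with $\ell(\mu)\le c_1$, $\mu_1<c_2$ (resp. $\ell(\nu)\le c_1$, $\nu_1<c_2$). Actions: $\pi\circ\mu=\pi\cdot\prod_{j=1}^{\ell(\mu)}(s_{c_1-j+1}s_{c_1-j+2}\cdots s_{c_1-j+\mu_j})$ (factors in order $j=1,2,\dots$ left to right), and $\nu\circ\pi=F_{\ell(\nu)}\cdots F_1\cdot\pi$ with $F_j=s_{c_1-j+\nu_j}\cdots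 s_{c_1-j+2}s_{c_1-j+1}$. A jump partition is a pair $J=(\mu,\nu)$ of size $|\mu|+|\nu|$, with $J(\pi)=\nu\circ(\pi\circ\mu)$; it is valid for $\pi$ if the shape of $J(\pi)$ equals the shape of $\pi$. *)

(* Defs.v *)
From mathcomp Require Import all_boot all_fingroup.

Set Implicit Arguments.
Unset Strict Implicit.
Unset Printing Implicit Defensive.

Definition is_part (la : seq nat) : bool := sorted geq la && (0 \notin la).

Definition is_part_of (n : nat) (la : seq nat) : bool :=
  is_part la && (sumn la == n).

Definition conj_part (la : seq nat) : seq nat :=
  [seq count (fun p => i < p) la | i <- iota 0 (head 0 la)].

(* Schensted row insertion: [x] replaces the leftmost larger entry of the first
   row, which is bumped into the next row, or is appended if there is none. *)
Fixpoint row_insert (t : seq (seq nat)) (x : nat) : seq (seq nat) :=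
  if t is row :: t' then
    let i := find (fun y => x < y) row in
    set_nth 0 row i x ::
      (if i < size row then row_insert t' (nth 0 row i) else t')
  else [:: [:: x]].

Definition RS_shape (w : seq nat) : seq nat :=
  [seq size row | row <- foldl row_insert [::] w].

(* ['S_n] permutes {0, ..., n-1}; the one-line word takes values in
   {1, ..., n}. *)
Definition one_line n (sigma : 'S_n) : seq nat :=
  [seq (sigma i).+1 | i <- enum 'I_n].

Definition perm_shape n (sigma : 'S_n) : seq nat := RS_shape (one_line sigma).

Definition inv_num n (sigma : 'S_n) : nat :=
  #|[set p : 'I_n * 'I_n | (p.1 < p.2) && (sigma p.2 < sigma p.1)]|.

(* The default [sigma] of the arg min is irrelevant: it satisfies the side
   condition whenever the first conjunct holds. *)
Definition W n (la : seq nat) (Delta : nat) : {set 'S_n} :=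
  [set sigma : 'S_n |
    (perm_shape sigma == la) &&
    (inv_num sigma ==
       inv_num [arg min_(tau < sigma | perm_shape tau == la) inv_num tau] + Delta)].

(* The transposition (t t+1) of {1, ..., n}, that is, of the ordinals t-1 and t.
   Out of the range 1 <= t < n, it is the identity. *)
Definition adj n (t : nat) : 'S_n :=
  if (insub t.-1, insub t) is (Some i, Some j) then tperm i j else 1%g.

(* [(a * b)%g] is "first [a], then [b]", so multiplying by [adj n t] on the left
   swaps the entries at positions t and t+1, and multiplying by it on the right
   swaps the values t and t+1. *)
Definition swap_pos n (sigma : 'S_n) (t : nat) : 'S_n := (adj n t * sigma)%g.
Definition swap_val n (sigma : 'S_n) (t : nat) : 'S_n := (sigma * adj n t)%g.

(* The indices c - j + 1, ..., c - j + mu_j for j = 1, 2, ..., in the order in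
   which the transpositions act: left to right in the product
   pi . prod_j (s_(c-j+1) ... s_(c-j+mu_j)), and right to left in
   F_l ... F_1 . pi with F_j = s_(c-j+mu_j) ... s_(c-j+1). *)
Definition jump_indices (c : nat) (mu : seq nat) : seq nat :=
  flatten [seq [seq c - j + i | i <- iota 1 (nth 0 mu j.-1)]
          | j <- iota 1 (size mu)].

Definition inner_act n (c : nat) (sigma : 'S_n) (mu : seq nat) : 'S_n :=
  foldl (@swap_pos n) sigma (jump_indices c mu).

Definition outer_act n (c : nat) (nu : seq nat) (sigma : 'S_n) : 'S_n :=
  foldl (@swap_val n) sigma (jump_indices c nu).

(* A minimal pi = (c1, c1-1, ..., 1, n, ..., c1+1) starts with the value c1. *)
Definition c1 n (pi : 'S_n) : nat := head 0 (one_line pi).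
Definition c2 n (pi : 'S_n) : nat := n - c1 pi.

Definition bounded_part (a b : nat) (mu : seq nat) : bool :=
  [&& is_part mu, size mu <= a & head 0 mu < b].

Definition jump_part n (pi : 'S_n) (J : seq nat * seq nat) : bool :=
  bounded_part (c1 pi) (c2 pi) J.1 && bounded_part (c1 pi) (c2 pi) J.2.

Definition jump_size (J : seq nat * seq nat) : nat := sumn J.1 + sumn J.2.

Definition jump n (J : seq nat * seq nat) (pi : 'S_n) : 'S_n :=
  outer_act (c1 pi) J.2 (inner_act (c1 pi) pi J.1).

Definition valid_jump n (J : seq nat * seq nat) (pi : 'S_n) : bool :=
  perm_shape (jump J pi) == perm_shape pi.

(* Main.v *)
Require Import Defs.
From mathcomp Require Import all_boot all_fingroup.
From mathcomp Require Import zify.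

(* By Schensted's theorem, sigma has shape la iff it has no increasing
   subsequence of length 3 and its longest decreasing subsequence has length s.
   Call a pair of positions whose entries are in increasing order a rise. A
   longest decreasing subsequence leaves r elements out, every rise contains one
   of them, and each of them is in at most s rises; so there are at most r s
   rises, and the minimal permutations are those with r s rises. If fewer than r
   rises are missing, some element t is in s rises, and maximality of the s
   elements that are comparable to t forces the poset of rises to be bipartite
   with blocks of sizes r and s and without isolated elements: the block of the
   non-maximal elements is the lower block. A jump partition (mu, nu) records
   the sets of positions and of values of the lower block as partitions in a
   box, and |mu| + |nu| is the number of missing rises, since no pair of
   elements of different blocks is out of order in both position and value.
   Conversely, if |mu| + |nu| < r, then each element of J(pi) is in a rise, so
   the lower block, hence (pi, J), can be recovered from J(pi). *)

(** * Row insertion and decreasing subsequences *)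

Definition row_ins (row : seq nat) (x : nat) : seq nat :=
  set_nth 0 row (find (fun y => x < y) row) x.

Lemma find_sorted (row : seq nat) (x : nat) :
  sorted leq row ->
  all (fun y => y <= x) (take (find (fun y => x < y) row) row) /\
  all (fun y => x < y) (drop (find (fun y => x < y) row) row).
Proof.
elim: row => [//|a row IH] /= srow.
have /IH[IH1 IH2] := path_sorted srow.
case: ltnP => [xa|ax] /=; last by rewrite ax.
split=> //; rewrite xa /=.
move: (order_path_min leq_trans srow); apply: sub_all => y /=; lia.
Qed.

Lemma row_insE (row : seq nat) (x : nat) :
  row_ins row x = take (find (fun y => x < y) row) row
                    ++ x :: drop (find (fun y => x < y) row).+1 row.
Proof. rewrite /row_ins; elim: row => //= a row IH; case: ltnP => _ /=; first by rewrite drop0.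
by rewrite IH. Qed.

Lemma row_bumpE (row : seq nat) (x : nat) :
  let i := find (fun y => x < y) row in i < size row ->
  row = take i row ++ nth 0 row i :: drop i.+1 row.
Proof. by move=> i ir; rewrite -drop_nth ?cat_take_drop. Qed.

Lemma sorted_row_ins (row : seq nat) (x : nat) :
  sorted leq row -> sorted leq (row_ins row x).
Proof.
move=> srow; rewrite row_insE; have [] := find_sorted row x srow.
set i := find _ _ => h1 h2.
have tl : transitive leq := leq_trans.
have := srow; rewrite -{1}(cat_take_drop i row) !(sorted_pairwise tl) !pairwise_cat.
case/and3P=> h3 h4 h5; rewrite h4 /=.
have -> : drop i.+1 row = behead (drop i row) by rewrite -drop1 drop_drop.
case: (drop i row) h2 h3 h5 => [|a l] /=.
  by move=> _ _ _; rewrite allrel_consr allrel0r h1 andbT.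
case/andP=> xa xl; rewrite !allrel_consr => /andP[_ ->] /andP[_ ->].
rewrite h1 !andbT /=; apply: sub_all xl => y; exact: ltnW.
Qed.

Definition has_dec (k : nat) (w : seq nat) : Prop :=
  exists u, [/\ subseq u w, sorted gtn u & size u = k].

Definition has_inc (k : nat) (w : seq nat) : Prop :=
  exists u, [/\ subseq u w, sorted ltn u & size u = k].

Lemma geq_trans : transitive geq.
Proof. by move=> ? ? ? /= h1 h2; apply: leq_trans h2 h1. Qed.

Lemma gtn_trans : transitive gtn.
Proof. move=> y x z /=; lia. Qed.

Lemma subseq_catE (T : eqType) (u a b : seq T) :
  subseq u (a ++ b) ->
  exists ua ub, [/\ u = ua ++ ub, subseq ua a & subseq ub b].
Proof.
elim: a u => [|x a IH] u /=; first by exists [::], u.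
case: u => [|y u] /=; first by exists [::], [::]; rewrite !sub0seq.
case: eqP => [->|_] /IH[ua [ub [e sa sb]]].
  by exists (x :: ua), ub; split; rewrite ?e //= eqxx.
by exists ua, ub; split=> //; apply: subseq_trans sa (subseq_cons _ _).
Qed.

(* A decreasing word may be replaced inside a decreasing sequence by one of the
   same length with smaller head and larger last letter. *)
Definition dec_le (m m' : seq nat) : Prop :=
  forall d, subseq d m -> sorted gtn d ->
  exists d', [/\ subseq d' m', sorted gtn d', size d' = size d,
                 head 0 d' <= head 0 d & last 0 d <= last 0 d'].

(** The letters taken from [a] exceed [head 0 d] and those taken from [b] are below [last 0 d], so
    the two bounds in [dec_le] let [d'] take the place of [d]. *)
Lemma has_dec_mid (k : nat) (a b m m' : seq nat) :
  dec_le m m' -> has_dec k (a ++ m ++ b) -> has_dec k (a ++ m' ++ b).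
Proof.
move=> hm [u [/subseq_catE[ua [v [-> sa /subseq_catE[d [ub [-> sd sb]]]]]] su <-]].
(* An empty [d] has only the default 0 as [head] and [last], so it is treated apart. *)
have [d0|d0] := eqVneq (size d) 0.
  exists (ua ++ ub); rewrite (size0nil d0) /= in su *; split=> //.
  by rewrite cat_subseq //; apply: subseq_trans sb (suffix_subseq _ _).
move: su; rewrite !(sorted_pairwise gtn_trans) !pairwise_cat -!(sorted_pairwise gtn_trans).
rewrite allrel_catr => /and3P[/andP[h1 h2] h3 /and3P[h4 h5 h6]].
have [d' [sd' dd' zd' hd' ld']] := hm d sd h5.
exists (ua ++ d' ++ ub); split; rewrite ?size_cat ?zd' //.
  by rewrite !cat_subseq.
rewrite !(sorted_pairwise gtn_trans) !pairwise_cat -!(sorted_pairwise gtn_trans).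
rewrite allrel_catr h2 h3 dd' h6 !andbT.
case: d d' d0 h1 h4 h5 zd' hd' ld' dd' sd sd' => [//|x d] [//|x' d'] _ h1 h4 h5 _ /= hx hl dd' _ _.
apply/andP; split.
  apply/allrelP => p q /(allrelP h1) H.
  have /= := H x (mem_head _ _); rewrite inE => px /predU1P[->|]; first lia.
  by move/(allP (order_path_min gtn_trans dd')) => /=; lia.
apply/allrelP => p q hp hq0.
have /= hq := allrelP h4 (last x d) q (mem_last _ _) hq0.
suff hp' : last x' d' <= p by exact: leq_trans hq (leq_trans hl hp').
case/lastP: d' dd' hp {hl} => [|d' z]; first by rewrite inE => _ /eqP->.
rewrite last_rcons -rcons_cons mem_rcons inE.
rewrite -[path _ _ _]/(sorted gtn (x' :: rcons d' z)) -rcons_cons.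
rewrite (sorted_pairwise gtn_trans) pairwise_rcons.
case/andP=> /allP H _ /predU1P[->//|/H /=]; exact: ltnW.
Qed.

Lemma sorted_leq_dec (u row : seq nat) :
  sorted leq row -> subseq u row -> sorted gtn u -> size u <= 1.
Proof.
move=> srow /(subseq_sorted leq_trans) /(_ srow).
by case: u => [|a [|b u]] //= /andP[ab _] /andP[ba _]; lia.
Qed.

(** A row is weakly increasing, so a decreasing subsequence of [row ++ [:: x]] has at most two
    letters. A pair [e, x] becomes [y, x], where the bumped letter [y] is the least entry above
    [x]. *)
Lemma row_ins_dec (row : seq nat) (x : nat) :
  let i := find (fun y => x < y) row in
  sorted leq row -> i < size row ->
  dec_le (row ++ [:: x]) (nth 0 row i :: row_ins row x).
Proof.
move=> i srow ir d /subseq_catE[d1 [d2 [-> s1 s2]]].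
have [h1 h2] := find_sorted row x srow.
have xy : x < nth 0 row i by apply: (nth_find 0 (a := fun y => x < y)); rewrite has_find.
have xin : x \in row_ins row x by rewrite row_insE mem_cat mem_head orbT.
rewrite (sorted_pairwise gtn_trans) pairwise_cat -!(sorted_pairwise gtn_trans).
case/and3P=> h d1s d2s.
have := sorted_leq_dec _ _ srow s1 d1s.
have : size d2 <= 1 by rewrite (size_subseq s2).
case: d2 s2 h {d2s} => [|z []] //.
  move=> _ _ _; case: d1 s1 {d1s} => [|e []] // s1 _; first by exists [::].
  have [ey|ey] := eqVneq e (nth 0 row i).
    by exists [:: e]; rewrite /= ey eqxx sub0seq.
  exists [:: e]; split=> //; rewrite sub1seq.
  move: s1; rewrite sub1seq {1}(row_bumpE row x ir) -/i row_insE -/i.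
  by rewrite !(mem_cat, inE) (negPf ey) /=; case/orP=> ->; rewrite ?orbT.
rewrite sub1seq inE => /eqP-> h _.
case: d1 s1 h {d1s} => [|e []] // s1 h _.
  by exists [:: x]; rewrite sub1seq inE xin orbT.
exists [:: nth 0 row i; x]; split=> //=; rewrite ?xy ?eqxx ?sub1seq //.
have xe : x < e by move: h; rewrite allrel_consl /= andbT => /andP[].
move: s1; rewrite sub1seq -{1}(cat_take_drop i row) mem_cat.
case/orP=> [/(allP h1)|]; first by lia.
rewrite (drop_nth 0 ir) inE => /predU1P[->//|].
have := drop_sorted i srow; rewrite (drop_nth 0 ir) /=.
by move/(order_path_min leq_trans) => /allP H /H.
Qed.

(** A letter of the new row that is smaller than the bumped letter [y] is at most [x], so [y, x]
    takes the place of the pair. *)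
Lemma dec_row_ins (row : seq nat) (x : nat) :
  let i := find (fun y => x < y) row in
  sorted leq row -> i < size row ->
  dec_le (nth 0 row i :: row_ins row x) (row ++ [:: x]).
Proof.
move=> i srow ir d sd dd.
have [h1 h2] := find_sorted row x srow.
have xy : x < nth 0 row i by apply: (nth_find 0 (a := fun y => x < y)); rewrite has_find.
have yin : nth 0 row i \in row by rewrite mem_nth.
have sins := sorted_row_ins row x srow.
have sub e : e \in row_ins row x -> e \in row ++ [:: x].
  rewrite row_insE -/i !(mem_cat, inE).
  case/or3P=> [/mem_take->//|->|/mem_drop->//]; exact: orbT.
case: d sd dd => [|e d]; first by exists [::]; split; rewrite ?sub0seq.
rewrite [subseq _ _]/=; case: eqP => [->|_] sd dd.
  have : size d <= 1 by apply: sorted_leq_dec sins sd (path_sorted dd).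
  case: d sd dd => [|f []] // sd dd _.
    by exists [:: nth 0 row i]; rewrite sub1seq mem_cat yin.
  exists [:: nth 0 row i; x]; split=> //=; rewrite ?xy //.
    by rewrite -[[:: _; _]]/([:: _] ++ [:: x]) cat_subseq // sub1seq.
  move: sd dd; rewrite sub1seq row_insE -/i mem_cat inE.
  case/or3P=> [/(allP h1)//|/eqP->//|].
  move=> fd; have := drop_sorted i srow; rewrite (drop_nth 0 ir) /=.
  by move/(order_path_min leq_trans) => /allP /(_ f fd); lia.
have := sorted_leq_dec _ _ sins sd dd; case: d sd dd => // sd _ _.
by exists [:: e]; split=> //; rewrite sub1seq sub // -sub1seq.
Qed.

(** * Insertion tableaux and longest decreasing subsequences *)

(** Rows are read from the last to the first, so a bumped letter written to the left of its old row
    stands right after the rows that it enters. *)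
Definition reading_word (t : seq (seq nat)) : seq nat := flatten (rev t).

Lemma reading_word_cons (row : seq nat) (t : seq (seq nat)) :
  reading_word (row :: t) = reading_word t ++ row.
Proof. by rewrite /reading_word rev_cons flatten_rcons. Qed.

(** The condition on first letters makes the first column, read upwards, a decreasing subsequence of
    the reading word. *)
Definition is_tab (t : seq (seq nat)) : bool :=
  [&& all (sorted leq) t, [::] \notin t & sorted ltn [seq head 0 row | row <- t]].

Lemma row_insert_consE (row : seq nat) (t : seq (seq nat)) (x : nat) :
  row_insert (row :: t) x =
    row_ins row x ::
      (let i := find (fun y => x < y) row in
       if i < size row then row_insert t (nth 0 row i) else t).
Proof. by []. Qed.

(** The claim on the corner entry feeds the induction: after a bump, it compares the first letter of
    the new row with that of the row below. *)
Lemma is_tab_row_insert (t : seq (seq nat)) (x : nat) :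
  is_tab t ->
  is_tab (row_insert t x) /\
  head 0 (head [::] (row_insert t x)) =
    if t is row :: _ then minn x (head 0 row) else x.
Proof.
elim: t x => [|row t IH] x //.
case/and3P; rewrite [all _ _]/= [map _ _]/= inE negb_or eq_sym.
case/andP=> srow st /andP[nrow nt] pt.
have [h1 h2] := find_sorted row x srow.
have tt : is_tab t by rewrite /is_tab st nt (path_sorted pt).
have hd : head 0 (row_ins row x) = minn x (head 0 row).
  case: row nrow srow {pt h1 h2} => // a row _ srow.
  rewrite /row_ins /=; case: ltnP => /=; lia.
rewrite row_insert_consE; set i := find _ _ in h1 h2 *; cbv zeta.
have ni : [::] != row_ins row x by rewrite row_insE; case: (take _ _).
split=> //; rewrite /is_tab [all _ _]/= sorted_row_ins // inE (negPf ni) /=.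
case: ltnP => ir; last first.
  rewrite st nt /= hd; case: t pt {IH st nt tt} => //= b t /andP[ab ->].
  rewrite andbT; lia.
have [/and3P[-> -> pt'] hd'] := IH (nth 0 row i) tt.
rewrite /= hd.
have xy : x < nth 0 row i by apply: (nth_find 0 (a := fun y => x < y)); rewrite has_find.
have hy : head 0 row <= nth 0 row i.
  case: row srow {nrow pt h1 h2 hd ni hd' pt'} i ir xy => // a row.
  move=> srow i ir _; have := order_path_min leq_trans srow.
  by case: i ir => //= i ir /allP; apply; rewrite mem_nth.
case: (row_insert t _) pt' hd' => //= r1 t1 -> ->; rewrite andbT.
case: t pt {IH st nt tt} => /= [_|r2 t2 /andP[h _]]; last lia.
lia.
Qed.

(** Each bump trades [row ++ [:: x]] for the bumped letter followed by the new row, which keeps the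
    lengths of decreasing subsequences in both directions. The suffix [b] is arbitrary since it
    absorbs the rows above. *)
Lemma has_dec_row_insert (k : nat) (t : seq (seq nat)) (x : nat) (b : seq nat) :
  all (sorted leq) t ->
  has_dec k (reading_word t ++ x :: b) <->
  has_dec k (reading_word (row_insert t x) ++ b).
Proof.
elim: t x b => [|row t IH] x b // /andP[srow st].
rewrite row_insert_consE; set i := find _ _; cbv zeta.
rewrite !reading_word_cons -!catA.
case: ltnP => ir.
  rewrite -(IH (nth 0 row i)) // -(cat1s x b) (catA row) -cat_cons.
  by split; apply: has_dec_mid; [exact: row_ins_dec | exact: dec_row_ins].
have -> : row_ins row x = row ++ [:: x]; last by rewrite -catA.
by rewrite row_insE take_oversize // drop_oversize // ltnW.
Qed.

Lemma has_dec_insertion (k : nat) (t : seq (seq nat)) (w : seq nat) :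
  is_tab t ->
  has_dec k (reading_word t ++ w) <->
  has_dec k (reading_word (foldl row_insert t w)).
Proof.
elim: w t => [|x w IH] t tt /=; first by rewrite cats0.
have /and3P[st _ _] := tt; rewrite (has_dec_row_insert k _ x w st).
by apply: IH; have [] := is_tab_row_insert t x tt.
Qed.

Lemma is_tab_insertion (w : seq nat) : is_tab (foldl row_insert [::] w).
Proof.
by elim/last_ind: w => // w x IH; rewrite foldl_rcons; have [] := is_tab_row_insert _ x IH.
Qed.

Lemma has_dec_tab_le (k : nat) (t : seq (seq nat)) :
  is_tab t -> has_dec k (reading_word t) -> k <= size t.
Proof.
case/and3P=> st _ _; elim: t k st => [|row t IH] k /=.
  by move=> _ [u []]; rewrite subseq0 => /eqP-> _ <-.
case/andP=> srow st [u []]; rewrite reading_word_cons.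
case/subseq_catE=> [ua [ub [-> sa sb]]] /cat_sorted2[da db] <-.
rewrite size_cat -addn1 leq_add ?(sorted_leq_dec ub row) //.
by apply: IH => //; exists ua.
Qed.

Lemma has_dec_tab (t : seq (seq nat)) : is_tab t -> has_dec (size t) (reading_word t).
Proof.
case/and3P=> _ nt st; exists (rev [seq head 0 row | row <- t]); split.
- elim: t nt {st} => //= row t IH; rewrite inE negb_or eq_sym => /andP[nrow nt].
  rewrite reading_word_cons rev_cons -cats1 cat_subseq ?IH // sub1seq.
  by case: row nrow => //= a l _; rewrite mem_head.
- by rewrite rev_sorted.
- by rewrite size_rev size_map.
Qed.

Lemma RS_shape_size_le (k : nat) (w : seq nat) : has_dec k w -> k <= size (RS_shape w).
Proof.
rewrite size_map => /(has_dec_insertion k [::] w isT).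
exact: has_dec_tab_le (is_tab_insertion w).
Qed.

Lemma has_dec_RS_shape (w : seq nat) : has_dec (size (RS_shape w)) w.
Proof.
by rewrite size_map; apply/(has_dec_insertion _ [::] w isT)/has_dec_tab/is_tab_insertion.
Qed.

(** * The first row and increasing subsequences *)

Lemma RS_shape_head_rcons (w : seq nat) (x : nat) :
  head [::] (foldl row_insert [::] (rcons w x)) =
  row_ins (head [::] (foldl row_insert [::] w)) x.
Proof. by rewrite foldl_rcons; case: (foldl _ _ _). Qed.

(* The [k]-th entry of the first row is the least last letter of an increasing
   subsequence of length [k + 1]. *)
Lemma RS_first_row_inc (w u : seq nat) (z : nat) :
  let row := head [::] (foldl row_insert [::] w) in
  subseq (rcons u z) w -> sorted ltn (rcons u z) ->
  size u < size row /\ nth 0 row (size u) <= z.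
Proof.
move=> row; rewrite {}/row; elim/last_ind: w u z => [|w x IH] u z; first by rewrite subseq0; case: u.
rewrite RS_shape_head_rcons; move: IH; set row := head _ _ => /= IH su du.
have srow : sorted leq row.
  have /and3P[] := is_tab_insertion w.
  by rewrite /row; case: (foldl _ _ _) => //= ? ? /andP[].
have [h1 h2] := find_sorted row x srow.
set i := find _ _ in h1 h2.
have zi : size (row_ins row x) = maxn i.+1 (size row) by rewrite size_set_nth.
have nthi k : nth 0 (row_ins row x) k = if k == i then x else nth 0 row k.
  by rewrite nth_set_nth.
rewrite zi nthi.
(* Either the subsequence avoids the new letter [x], and insertion can only lower an entry of the
   row, or it ends in [x]. *)
have : subseq (rcons u z) w \/ z = x /\ subseq u w.
  move: su; rewrite -!cats1 => /subseq_catE[ua [ub [e sa sb]]].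
  case: ub e sb => [|b [|c ub]]; last by move=> _ /size_subseq.
    by rewrite cats0 => ->; left.
  rewrite !cats1 => /eqP; rewrite eqseq_rcons => /andP[/eqP-> /eqP->].
  by rewrite sub1seq inE => /eqP->; right.
case=> [/IH/(_ du)[k1 k2]|[zx {}su]]; last rewrite {z}zx in du *.
  split; first by rewrite leq_max k1 orbT.
  case: eqP => // e; apply: leq_trans k2; apply: ltnW.
  by rewrite e in k1 *; apply: (nth_find 0 (a := fun y => x < y)); rewrite has_find.
(* Left of the place [i] of [x] the entries are at most [x], so it is enough that [x] lands at or
   after index [size u]. *)
suff k : size u <= i.
  split; first by rewrite leq_max ltnS k.
  case: eqP => // /eqP ne.
  have ki : size u < i by rewrite ltn_neqAle ne.
  by rewrite leqNgt (before_find 0 (a := fun y => x < y)).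
case/lastP: u su du => // u y su du.
have yx : y < x.
  by move: du; rewrite -cats1 cat_rcons sorted_cat_cons /= andbT => /andP[].
have [k1 k2] := IH u y su (subseq_sorted ltn_trans (subseq_rcons _ _) du).
rewrite size_rcons ltnNge; apply/negP => k.
have : nth 0 row (size u) \in drop i row.
  by rewrite -(subnKC k) -nth_drop mem_nth // size_drop ltn_sub2r // (leq_ltn_trans k).
by move/(allP h2) => /=; lia.
Qed.

Lemma RS_shape_head_le (k : nat) (w : seq nat) : has_inc k w -> k <= head 0 (RS_shape w).
Proof.
move=> [u [su du <-]]; case/lastP: u su du => // u z su du.
have [h _] := RS_first_row_inc w u z su du.
by rewrite size_rcons; move: h; rewrite /RS_shape; case: (foldl _ _ _).
Qed.

(** * Rises *)

Definition rise {n} (sigma : 'S_n) (i j : 'I_n) : bool := (i < j) && (sigma i < sigma j).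

Definition riseless {n} (sigma : 'S_n) (X : {set 'I_n}) : Prop :=
  {in X &, forall i j, ~~ rise sigma i j}.

Definition rise_num {n} (sigma : 'S_n) : nat :=
  #|[set p : 'I_n * 'I_n | rise sigma p.1 p.2]|.

Lemma riseless_lt {n} (sigma : 'S_n) (X : {set 'I_n}) :
  riseless sigma X -> {in X &, forall i j : 'I_n, i < j -> sigma j < sigma i}.
Proof.
move=> h i j iX jX ij; have := h i j iX jX; rewrite /rise ij -leqNgt leq_eqVlt.
by case/predU1P=> // /val_inj/perm_inj e; rewrite e ltnn in ij.
Qed.

Lemma enum_filter (T : finType) (A : {pred T}) : enum A = filter (mem A) (enum T).
Proof. by rewrite enumT. Qed.

Lemma sorted_enum_ord {n} (X : {pred 'I_n}) : sorted (fun i j : 'I_n => i < j) (enum X).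
Proof.
have tr : transitive (fun i j : 'I_n => i < j) by move=> ? ? ?; apply: ltn_trans.
rewrite enum_filter; apply: sorted_filter => //.
by have := iota_ltn_sorted 0 n; rewrite -val_enum_ord sorted_map.
Qed.

(** Used with [gtn] for sets without rises and with [ltn] for chains of rises. *)
Lemma subseq_one_line {n} (sigma : 'S_n) (X : {set 'I_n}) (r : rel nat) :
  {in X &, forall i j : 'I_n, i < j -> r (sigma i).+1 (sigma j).+1} ->
  exists u, [/\ subseq u (one_line sigma), sorted r u & size u = #|X|].
Proof.
move=> h; exists [seq (sigma i).+1 | i <- enum X]; split.
- by rewrite map_subseq // enum_filter filter_subseq.
- rewrite sorted_map; apply: (@sub_in_sorted _ (mem X) (fun i j : 'I_n => i < j)).
  + by move=> i j iX jX; apply: h.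
  + by apply/allP => i; rewrite mem_enum.
  + exact: sorted_enum_ord.
- by rewrite size_map cardE.
Qed.

Lemma riseless_size {n} (sigma : 'S_n) (X : {set 'I_n}) :
  riseless sigma X -> #|X| <= size (perm_shape sigma).
Proof.
move=> h; apply: RS_shape_size_le; apply: subseq_one_line => i j iX jX ij /=.
exact: (riseless_lt _ _ h).
Qed.

Lemma pairwise_mem (T : eqType) (r : rel T) (s : seq T) (x y : T) :
  pairwise r s -> x \in s -> y \in s -> [|| x == y, r x y | r y x].
Proof.
elim: s => //= a s IH /andP[/allP h ps].
rewrite !inE => /predU1P[->|xs] /predU1P[->|ys]; rewrite ?eqxx //.
- by rewrite h ?orbT.
- by rewrite h ?orbT.
- exact: IH.
Qed.

(** The set consists of the positions of a longest decreasing subsequence. *)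
Lemma ex_riseless {n} (sigma : 'S_n) :
  exists X : {set 'I_n}, riseless sigma X /\ #|X| = size (perm_shape sigma).
Proof.
have [u [/subseqP[m _ ->] su <-]] := has_dec_RS_shape (one_line sigma).
rewrite -map_mask in su *; set w := mask m _ in su *.
have uw : uniq w by rewrite mask_uniq ?enum_uniq.
exists [set i in w]; split; last by rewrite cardsE size_map; apply/card_uniqP.
have tr : transitive (fun i j : 'I_n => i < j) by move=> ? ? ?; apply: ltn_trans.
have pw : pairwise (fun i j : 'I_n => i < j) w.
  by rewrite -(sorted_pairwise tr) (sorted_mask tr) ?sorted_enum_ord.
move: su; rewrite (sorted_pairwise gtn_trans) pairwise_map => pw'.
have pq : pairwise (fun i j : 'I_n => (i < j) && (sigma j < sigma i)) w.
  elim: w {uw} pw pw' => //= a w IH /andP[h1 h2] /andP[h3 h4].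
  by rewrite IH // andbT -[all _ _]/(all (predI (fun j : 'I_n => a < j) _) w) all_predI h1.
move=> i j; rewrite !inE => iw jw.
have := pairwise_mem _ _ _ _ _ pq iw jw; rewrite /rise.
case/or3P=> [/eqP->|/andP[_ k]|/andP[k _]]; first by rewrite ltnn.
  by rewrite (ltnNge (sigma i)) (ltnW k) andbF.
by rewrite (ltnNge i) (ltnW k).
Qed.

(** Two consecutive rises form an increasing subsequence of length 3, which the first row has no
    room for. *)
Lemma rise_chain {n} (sigma : 'S_n) (i j k : 'I_n) :
  head 0 (perm_shape sigma) <= 2 -> rise sigma i j -> rise sigma j k -> False.
Proof.
move=> h /andP[ij sij] /andP[jk sjk].
have [|u hu] := subseq_one_line sigma [set i; j; k] ltn.
  move=> a b; rewrite !inE -!orbA.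
  by case/or3P=> /eqP->; case/or3P=> /eqP-> /=; lia.
have card3 : #|[set i; j; k]| = 3.
  rewrite setUC cardsU1 cards2 !inE -!(inj_eq val_inj) /=.
  by rewrite (gtn_eqF jk) (gtn_eqF (ltn_trans ij jk)) (ltn_eqF ij).
have /RS_shape_head_le /leq_trans/(_ h) // : has_inc 3 (one_line sigma).
by exists u; rewrite -card3.
Qed.

(** * Counting rises by their endpoints *)

Definition ups {n} (sigma : 'S_n) (t : 'I_n) : {set 'I_n} := [set j | rise sigma t j].
Definition downs {n} (sigma : 'S_n) (t : 'I_n) : {set 'I_n} := [set i | rise sigma i t].
Definition lower {n} (sigma : 'S_n) : {set 'I_n} := [set i | [exists j, rise sigma i j]].

Lemma card_set_sum (T : finType) (P : pred T) : #|[set x | P x]| = \sum_x P x.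
Proof. by rewrite -sum1_card big_mkcond; apply: eq_bigr => x _; rewrite inE; case: (P x). Qed.

(** Every rise has an endpoint outside [X]; those with both endpoints outside are counted twice. *)
Lemma rise_num_le_deg {n} (sigma : 'S_n) (X : {set 'I_n}) :
  riseless sigma X ->
  rise_num sigma <= \sum_(t in ~: X) (#|ups sigma t| + #|downs sigma t|).
Proof.
move=> hX; rewrite /rise_num card_set_sum -(pair_bigA _ (fun i j => rise sigma i j : nat)) /=.
rewrite big_split /=.
apply: (@leq_trans (\sum_i \sum_j ((i \in ~: X) * rise sigma i j + (j \in ~: X) * rise sigma i j))).
  apply: leq_sum => i _; apply: leq_sum => j _; rewrite !inE.
  have := hX i j; case: (i \in X); case: (j \in X) => /=; lia.
under eq_bigr do rewrite big_split.
rewrite big_split leq_add //=.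
  rewrite [leqRHS]big_mkcond leq_sum // => i _.
  rewrite -big_distrr card_set_sum /=; by case: (i \in _); rewrite ?mul1n ?mul0n.
rewrite exchange_big [leqRHS]big_mkcond leq_sum // => j _.
rewrite -big_distrr card_set_sum /=; by case: (j \in _); rewrite ?mul1n ?mul0n.
Qed.

Definition two_column (s : nat) {n} (sigma : 'S_n) : Prop :=
  size (perm_shape sigma) = s /\ head 0 (perm_shape sigma) <= 2.

Lemma riseless_ups {n} (sigma : 'S_n) (t : 'I_n) :
  head 0 (perm_shape sigma) <= 2 -> riseless sigma (ups sigma t).
Proof.
move=> h i j; rewrite !inE => ti _; apply/negP; exact: (rise_chain _ _ _ _ h ti).
Qed.

Lemma riseless_downs {n} (sigma : 'S_n) (t : 'I_n) :
  head 0 (perm_shape sigma) <= 2 -> riseless sigma (downs sigma t).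
Proof.
move=> h i j; rewrite !inE => _ jt; apply/negP => ij; exact: (rise_chain _ _ _ _ h ij jt).
Qed.

(** A point cannot have rises on both sides, and its neighbours on one side form a set without
    rises, hence of size at most [s]. *)
Lemma deg_le {n} (sigma : 'S_n) (t : 'I_n) (s : nat) :
  two_column s sigma -> #|ups sigma t| + #|downs sigma t| <= s.
Proof.
move=> [hs h2]; rewrite -hs.
have [->|[i]] := set_0Vmem (downs sigma t).
  by rewrite cards0 addn0 riseless_size //; apply: riseless_ups.
rewrite inE => it; have -> : ups sigma t = set0.
  by apply/setP => j; rewrite !inE; apply/negP => /(rise_chain _ _ _ _ h2 it).
by rewrite cards0 riseless_size //; apply: riseless_downs.
Qed.

Lemma rise_num_le {n} (sigma : 'S_n) (s r : nat) :
  n = s + r -> two_column s sigma -> rise_num sigma <= r * s.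
Proof.
move=> nE ts; have [X [hX cX]] := ex_riseless sigma.
apply: leq_trans (rise_num_le_deg _ _ hX) _.
have -> : r = #|~: X|.
  have := cardsC X; rewrite cX card_ord; case: ts => -> _; lia.
by rewrite -sum_nat_const leq_sum // => t _; apply: deg_le.
Qed.

(* A maximum set without rises has [s] points. If fewer than [r] rises are
   missing, one of the [r] other points is in [s] rises; the other ends of
   these rises form a maximum set which is [lower sigma] or its complement. *)
Lemma lower_structure {n} (sigma : 'S_n) (s r Delta : nat) :
  0 < s -> n = s + r -> two_column s sigma -> rise_num sigma + Delta = r * s -> Delta < r ->
  [/\ (#|lower sigma| == s) || (#|lower sigma| == r),
      riseless sigma (lower sigma) & riseless sigma (~: lower sigma)].
Proof.
move=> s0 nE ts eE Dr; have [X [hX cX]] := ex_riseless sigma.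
have [hs h2] := ts.
have cC : #|~: X| = r by have := cardsC X; rewrite cX card_ord hs; lia.
(* By maximality, no point can be added to a riseless set of size [s]. *)
have ext (S : {set 'I_n}) i : riseless sigma S -> #|S| = s -> i \notin S ->
    exists2 j, j \in S & rise sigma i j || rise sigma j i.
  move=> hS cS iS; apply/exists_inP; apply: contraPT cS => /exists_inPn nS.
  suff /riseless_size : riseless sigma (i |: S) by rewrite cardsU1 iS hs; lia.
  move=> a b; rewrite !inE => /predU1P[->|aS] /predU1P[->|bS].
  - by rewrite /rise ltnn.
  - by have := nS b bS; case: (rise sigma i b).
  - by have := nS a aS; case: (rise sigma a i); rewrite ?orbT.
  - exact: hS.
have low i j : rise sigma i j -> i \in lower sigma by move=> ij; rewrite inE; apply/existsP; exists j.
have nlow i j : rise sigma i j -> j \notin lower sigma.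
  by move=> ij; rewrite inE; apply/existsP => -[k]; apply: (rise_chain _ _ _ _ h2 ij).
have rl : riseless sigma (lower sigma).
  by move=> i j _ jl; apply/negP => /nlow; rewrite jl.
have rC : riseless sigma (~: lower sigma).
  by move=> i j il _; apply/negP => /low; move: il; rewrite inE => /negP.
(* Otherwise each of the [r] points outside [X] is in at most [s - 1] rises, and at least [r] rises
   are missing, against [Delta < r]. *)
have [t dt] : exists t, #|ups sigma t| + #|downs sigma t| = s.
  suff /existsP[t /eqP] : [exists t, #|ups sigma t| + #|downs sigma t| == s] by exists t.
  apply: contraT => /existsPn nt.
  have : rise_num sigma <= r * s.-1.
    apply: leq_trans (rise_num_le_deg _ _ hX) _.
    rewrite -cC -sum_nat_const leq_sum // => t _.
    have := deg_le sigma t s ts; have /negP := nt t; lia.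
  by move: eE; rewrite -(ltn_predK s0) mulnS /=; lia.
(* Either all [s] neighbours of [t] are above it and form the complement of [lower sigma], or all
   are below it and form [lower sigma]. *)
have [d0|[i it]] := set_0Vmem (downs sigma t).
  rewrite d0 cards0 addn0 in dt.
  have uE : ~: ups sigma t = lower sigma.
    apply/setP => i; rewrite in_setC; apply/idP/idP => [iu|il].
      have [j] := ext _ _ (riseless_ups _ t h2) dt iu; rewrite inE => tj.
      by case/orP=> [/low//|/(rise_chain _ _ _ _ h2 tj)].
    by rewrite inE; apply/negP => /nlow; rewrite il.
  split=> //; apply/orP; right; rewrite -uE.
  by have := cardsC (ups sigma t); rewrite card_ord; lia.
have u0 : ups sigma t = set0.
  rewrite inE in it.
  by apply/setP => j; rewrite !inE; apply/negP => /(rise_chain _ _ _ _ h2 it).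
rewrite u0 cards0 add0n in dt.
have dC j : j \notin downs sigma t -> exists2 k, k \in downs sigma t & rise sigma k j.
  move=> jd; have [k kd] := ext _ _ (riseless_downs _ t h2) dt jd.
  case/orP=> [jk|kj]; last by exists k.
  by move: kd; rewrite inE => /(rise_chain _ _ _ _ h2 jk).
have dE : downs sigma t = lower sigma.
  apply/setP => j; apply/idP/idP => [|jl]; first by rewrite inE => /low.
  by apply: contraLR jl => /dC[k _ /nlow].
by split=> //; rewrite -dE dt eqxx.
Qed.

(** * Jumps as permutations *)

Definition adj_prod (n : nat) (s : seq nat) : 'S_n := (\prod_(t <- s) adj n t)%g.

Definition jump_perm (n c : nat) (mu : seq nat) : 'S_n := adj_prod n (jump_indices c mu).

Lemma adjV (n t : nat) : (adj n t)^-1%g = adj n t.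
Proof.
rewrite /adj; case: insub => [i|]; last exact: invg1.
by case: insub => [j|]; [exact: tpermV | exact: invg1].
Qed.

Lemma adjE (n t : nat) (x : 'I_n) :
  0 < t < n ->
  adj n t x = (if x == t.-1 :> nat then t else if x == t :> nat then t.-1 else x) :> nat.
Proof.
move=> /andP[t0 tn]; have tn' : t.-1 < n by lia.
rewrite /adj (insubT (fun i => i < n) tn') (insubT (fun i => i < n) tn) /=.
case: tpermP => [->|->|h1 h2] /=; first by rewrite eqxx.
  by rewrite eqxx; case: eqP => //; lia.
case: eqP => [e|_]; first by case: h1; apply: val_inj.
by case: eqP => [e|_] //; case: h2; apply: val_inj.
Qed.

Lemma foldl_swap_pos {n} (sigma : 'S_n) (s : seq nat) :
  foldl (@swap_pos n) sigma s = ((adj_prod n s)^-1 * sigma)%g.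
Proof.
rewrite /adj_prod; elim: s sigma => [|t s IH] sigma /=.
  by rewrite big_nil invg1 mul1g.
by rewrite IH big_cons invMg adjV /swap_pos mulgA.
Qed.

Lemma foldl_swap_val {n} (sigma : 'S_n) (s : seq nat) :
  foldl (@swap_val n) sigma s = (sigma * adj_prod n s)%g.
Proof.
rewrite /adj_prod; elim: s sigma => [|t s IH] sigma /=; first by rewrite big_nil mulg1.
by rewrite IH big_cons /swap_val mulgA.
Qed.

(** Acting on positions multiplies on the left and reverses the product, hence the inverse. In this
    form the position [g k] receives the value [h (pi k)], with [g] and [h] the jump permutations of
    [J.1] and [J.2]. *)
Lemma jumpE {n} (J : seq nat * seq nat) (pi : 'S_n) :
  jump J pi = ((jump_perm n (c1 pi) J.1)^-1 * pi * jump_perm n (c1 pi) J.2)%g.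
Proof. by rewrite /jump /outer_act /inner_act foldl_swap_val foldl_swap_pos. Qed.

(** The transposition of index [t] exchanges the ordinals [t.-1] and [t], so the indices
    [a + 1, ..., a + m] give a cycle on the ordinals [a, ..., a + m]. *)
Lemma adj_prod_cycle (n a m : nat) (x : 'I_n) :
  a + m < n ->
  adj_prod n [seq a + i | i <- iota 1 m] x =
    (if x == a :> nat then a + m else if a < x <= a + m then x.-1 else x) :> nat.
Proof.
elim: m => [|m IH] amn.
  rewrite /adj_prod big_nil perm1 addn0; do ! case: ifP => //; lia.
rewrite -[X in iota _ X]addn1 iotaD map_cat /adj_prod big_cat big_seq1 permM.
rewrite adjE; last lia.
rewrite IH; last lia.
do ! case: ifP; lia.
Qed.

Lemma jump_indices_rcons (c m : nat) (mu : seq nat) :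
  jump_indices c (rcons mu m) =
    jump_indices c mu ++ [seq c - (size mu).+1 + i | i <- iota 1 m].
Proof.
rewrite /jump_indices size_rcons -[X in iota _ X]addn1 iotaD map_cat flatten_cat.
rewrite /= cats0 nth_rcons ltnn eqxx; congr (flatten _ ++ _).
apply/eq_in_map => j; rewrite mem_iota nth_rcons => hj.
by rewrite (_ : j.-1 < size mu) //; lia.
Qed.

(** The cycle of the [j]-th part carries [c - j] up by that part. Since the parts decrease, the
    points carried earlier are already beyond its range. *)
Lemma jump_permP (n c : nat) (mu : seq nat) :
  let g := jump_perm n c mu in
  bounded_part c (n - c) mu ->
  [/\ forall k : 'I_n, k < c -> g k = k + nth 0 mu (c - k.+1) :> nat
    & forall k l : 'I_n, c <= k -> k < l -> g k < g l].
Proof.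
move=> g; rewrite {}/g => /and3P[/andP[smu _] zmu hmu].
elim/last_ind: mu smu zmu hmu => [|mu m IH] smu zmu hmu.
  rewrite /jump_perm /adj_prod big_nil; split=> [k _|k l _]; by rewrite !perm1 // nth_nil addn0.
move: zmu; rewrite size_rcons => zmu.
move: smu; rewrite (sorted_pairwise geq_trans) pairwise_rcons => /andP[/allP mmu].
rewrite -(sorted_pairwise geq_trans) => smu.
have hm : m < n - c.
  apply: leq_ltn_trans hmu; case: mu mmu {IH zmu smu} => //= a mu h.
  by apply: h; rewrite mem_head.
have hmu' : head 0 mu < n - c by case: mu hmu {IH zmu smu mmu} => //=; lia.
have [h1 h2] := IH smu (ltnW zmu) hmu'.
set g := jump_perm n c mu in h1 h2.
have gE (x : 'I_n) : jump_perm n c (rcons mu m) x =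
    (if g x == c - (size mu).+1 :> nat then c - (size mu).+1 + m else
     if c - (size mu).+1 < g x <= c - (size mu).+1 + m then (g x).-1 else g x) :> nat.
  rewrite /jump_perm jump_indices_rcons /adj_prod big_cat permM.
  by rewrite [LHS]adj_prod_cycle //; lia.
split=> [k kc|k l ck kl].
  rewrite gE /= (h1 k kc) nth_rcons.
  case: (ltngtP (c - k.+1) (size mu)) => h.
  - have := mmu _ (mem_nth 0 h) => /= mk.
    by do ! case: ifP; lia.
  - by rewrite nth_default; do ? case: ifP; lia.
  - by rewrite nth_default; do ? case: ifP; lia.
(* The value where the new cycle starts is held by a point below [c], so the points from [c] on
   avoid it, and the shift down by one keeps their order. *)
have ne (x : 'I_n) : c <= x -> (g x == c - (size mu).+1 :> nat) = false.
  move=> cx; have an : c - (size mu).+1 < n by lia.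
  have /= e : g (Ordinal an) = c - (size mu).+1 :> nat.
    by rewrite h1 /= ?nth_default; lia.
  apply/eqP => e'; have /perm_inj E : g x = g (Ordinal an) by apply: val_inj; rewrite /= e' e.
  by move: cx; rewrite E /=; lia.
rewrite !gE !ne //; last lia.
have := h2 k l ck kl.
have := ne k ck; have := ne l (leq_trans ck (ltnW kl)).
by do ! case: ifP; lia.
Qed.

(** Listing [C] in order turns both maps into [r]-sorted lists of the same set, and such a list is
    unique. The relation [r] is left open to cover increasing and decreasing maps. *)
Lemma monotone_imset_inj {n} (r : rel 'I_n) (C : {set 'I_n}) (f g : 'I_n -> 'I_n) :
  transitive r -> irreflexive r ->
  {in C &, forall k l : 'I_n, k < l -> r (f k) (f l)} ->
  {in C &, forall k l : 'I_n, k < l -> r (g k) (g l)} ->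
  f @: C = g @: C -> {in C, f =1 g}.
Proof.
move=> tr ir hf hg e.
have srt (h : 'I_n -> 'I_n) : {in C &, forall k l : 'I_n, k < l -> r (h k) (h l)} ->
    sorted r [seq h k | k <- enum C].
  move=> hh; rewrite sorted_map.
  apply: (@sub_in_sorted _ (mem C) (fun i j : 'I_n => i < j)) (sorted_enum_ord _).
    exact: hh.
  by apply/allP => i; rewrite mem_enum.
have E : [seq f k | k <- enum C] = [seq g k | k <- enum C].
  apply: (irr_sorted_eq tr ir (srt f hf) (srt g hg)) => x.
  apply/mapP/mapP => -[k]; rewrite mem_enum => kC ->.
    have /imsetP[l lC ->] : f k \in g @: C by rewrite -e imset_f.
    by exists l; rewrite ?mem_enum.
  have /imsetP[l lC ->] : g k \in f @: C by rewrite e imset_f.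
  by exists l; rewrite ?mem_enum.
by move/eq_in_map: E => E k kC; apply: E; rewrite mem_enum.
Qed.

(** * Partitions in a box as sets of ordinals *)

Definition firsts (n c : nat) : {set 'I_n} := [set k : 'I_n | k < c].

Lemma sum_firsts (n c : nat) (F : nat -> nat) :
  c <= n -> \sum_(k in firsts n c) F k = \sum_(0 <= i < c) F i.
Proof.
move=> cn; rewrite big_mkord (big_ord_widen _ _ cn).
by apply: eq_bigl => k; rewrite inE.
Qed.

Lemma card_firsts (n c : nat) : c <= n -> #|firsts n c| = c.
Proof. by move=> cn; rewrite -sum1_card (sum_firsts _ _ (fun=> 1)) // sum_nat_const_nat muln1 subn0. Qed.

(** This is the size of the partition whose parts are the displacements of the points of [P] from an
    initial segment, written as a count of pairs in order to compare it with rises. *)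
Definition cross_num {n} (P : {set 'I_n}) : nat :=
  #|[set p : 'I_n * 'I_n | [&& p.1 \in P, p.2 \notin P & p.2 < p.1]]|.

Lemma cross_numE {n} (P : {set 'I_n}) :
  cross_num P = \sum_(i in P) #|[set j | (j \notin P) && (j < i)]|.
Proof.
rewrite /cross_num card_set_sum -(pair_bigA _ (fun i j => [&& i \in P, j \notin P & j < i] : nat)) /=.
rewrite [RHS]big_mkcond; apply: eq_bigr => i _.
by rewrite card_set_sum; case: (i \in P) => //; rewrite big1.
Qed.

(** Of the [g k] ordinals below [g k], exactly [k] lie in the image of [firsts n c]. *)
Lemma cross_num_imset {n} (c : nat) (g : 'S_n) :
  c <= n -> {in firsts n c &, forall k l : 'I_n, k < l -> g k < g l} ->
  cross_num (g @: firsts n c) = \sum_(k in firsts n c) (g k - k).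
Proof.
move=> cn hg; rewrite cross_numE big_imset /=; last by move=> k l _ _; apply: perm_inj.
apply: eq_bigr => k kc.
have hk : g k = #|[set j : 'I_n | j < g k]| :> nat by rewrite [RHS]card_firsts // ltnW.
have hin : [set j : 'I_n | j < g k] :&: (g @: firsts n c) = g @: firsts n k.
  apply/setP => j; rewrite !inE; apply/andP/imsetP => [[jg /imsetP[l lc e]]|[l lk ->]].
    exists l => //; rewrite inE; rewrite e in jg; case: (ltngtP l k) => // kl.
      by have := hg k l kc lc kl; lia.
    by rewrite (val_inj kl) ltnn in jg.
  have lc : l \in firsts n c by move: kc lk; rewrite !inE => ? ?; lia.
  by rewrite imset_f // hg //; move: lk; rewrite inE.
have := cardsID (g @: firsts n c) [set j : 'I_n | j < g k].
rewrite -hk hin card_imset; last exact: perm_inj.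
rewrite (card_firsts n k (ltnW (ltn_ord k))) => e; rewrite -[in RHS]e addKn.
by apply: eq_card => j; rewrite !inE.
Qed.

Lemma nth_geq (s : seq nat) (i j : nat) : sorted geq s -> i <= j -> nth 0 s j <= nth 0 s i.
Proof.
move=> ss ij; case: (ltnP j (size s)) => hj; last by rewrite nth_default.
by apply: (sorted_leq_nth geq_trans leqnn 0 ss i j) => //; rewrite inE ?(leq_ltn_trans ij).
Qed.

Lemma sumn_nth (s : seq nat) (c : nat) : size s <= c -> \sum_(0 <= i < c) nth 0 s i = sumn s.
Proof.
move=> sc; rewrite sumnE [RHS](big_nth 0) (@big_cat_nat _ _ _ (size s) 0 c) //=.
by rewrite addnC big_nat_cond big1 // => i /andP[/andP[h _] _]; rewrite nth_default.
Qed.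

Lemma jump_perm_firsts_lt (n c : nat) (mu : seq nat) :
  bounded_part c (n - c) mu ->
  {in firsts n c &, forall k l : 'I_n, k < l -> jump_perm n c mu k < jump_perm n c mu l}.
Proof.
move=> hb k l; rewrite !inE => kc lc kl; have [h _] := jump_permP n c mu hb.
rewrite !h //; have /and3P[/andP[smu _] _ _] := hb.
have := nth_geq mu (c - l.+1) (c - k.+1) smu; lia.
Qed.

Lemma cross_num_jump_perm (n c : nat) (mu : seq nat) :
  c <= n -> bounded_part c (n - c) mu ->
  cross_num (jump_perm n c mu @: firsts n c) = sumn mu.
Proof.
move=> cn hb; rewrite cross_num_imset //; last exact: jump_perm_firsts_lt.
have [h _] := jump_permP n c mu hb; have /and3P[_ zmu _] := hb.
rewrite -(sumn_nth mu c zmu) big_nat_rev /= add0n.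
rewrite -(sum_firsts n c (fun k => nth 0 mu (c - k.+1))) //.
by apply: eq_bigr => k; rewrite inE => kc; rewrite h // addKn.
Qed.

(** [nth] pads with zeros, which reveals where a sequence without zero entries ends. *)
Lemma is_part_nth_inj (s s' : seq nat) :
  0 \notin s -> 0 \notin s' -> (forall i, nth 0 s i = nth 0 s' i) -> s = s'.
Proof.
move=> h h' e; apply: (@eq_from_nth _ 0) => //.
have lt (a b : seq nat) : 0 \notin b -> (forall i, nth 0 a i = nth 0 b i) -> size b <= size a.
  move=> hb eab; rewrite leqNgt; apply/negP => ab.
  by move: hb; rewrite -(nth_default 0 (leqnn (size a))) eab mem_nth.
by apply/eqP; rewrite eqn_leq !lt.
Qed.

Lemma jump_perm_imset_inj (n c : nat) (mu mu' : seq nat) :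
  c <= n -> bounded_part c (n - c) mu -> bounded_part c (n - c) mu' ->
  jump_perm n c mu @: firsts n c = jump_perm n c mu' @: firsts n c -> mu = mu'.
Proof.
move=> cn hb hb' e.
have tr : transitive (fun i j : 'I_n => i < j) by move=> ? ? ?; apply: ltn_trans.
have ir : irreflexive (fun i j : 'I_n => i < j) by move=> ?; apply: ltnn.
have := monotone_imset_inj _ _ _ _ tr ir
  (jump_perm_firsts_lt _ _ _ hb) (jump_perm_firsts_lt _ _ _ hb') e.
have [h _] := jump_permP n c mu hb; have [h' _] := jump_permP n c mu' hb'.
have /and3P[/andP[_ z] zmu _] := hb; have /and3P[/andP[_ z'] zmu' _] := hb'.
move=> E; apply: is_part_nth_inj => // i.
case: (ltnP i c) => ic; last by rewrite !nth_default // (leq_trans _ ic).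
have kn : c - i.+1 < n by lia.
have kc : Ordinal kn \in firsts n c by rewrite inE /=; lia.
have := congr1 val (E _ kc); rewrite inE in kc; rewrite /= h // h' //= => /addnI.
by have -> : c - (c - i.+1).+1 = i by lia.
Qed.

Lemma sorted_ltn_gap (s : seq nat) (i j : nat) :
  sorted ltn s -> i <= j -> j < size s -> nth 0 s i + (j - i) <= nth 0 s j.
Proof.
move=> ss; elim: j => [|j IH] ij js; first by move: ij; rewrite leqn0 => /eqP->; rewrite addn0.
case: (ltngtP i j.+1) ij => // [ij _|-> _]; last by rewrite subnn addn0.
have := IH ij (ltnW js).
have := sorted_ltn_nth ltn_trans 0 ss j j.+1; rewrite !inE => /(_ (ltnW js) js (ltnSn j)) /=; lia.
Qed.

Lemma nth_filter_pos (s : seq nat) (i : nat) :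
  sorted geq s -> nth 0 [seq m <- s | 0 < m] i = nth 0 s i.
Proof.
elim: s i => //= a s IH i sa; have := order_path_min geq_trans sa.
case: posnP => [-> /allP h|_ _]; last by case: i => //= i; rewrite IH ?(path_sorted sa).
rewrite (eq_in_filter (a2 := pred0)); last by move=> m /h /=; case: m.
rewrite filter_pred0 nth_nil; case: i => //= i.
by case: (ltnP i (size s)) => hi; [have /h /= := mem_nth 0 hi; lia | rewrite nth_default].
Qed.

(** The parts are the nonzero displacements of the points of [P], from the largest point down. That
    the last ordinal is not in [P] makes the largest part less than [n - c]. *)
Lemma ex_jump_perm (n c : nat) (P : {set 'I_n}) :
  #|P| = c -> c < n -> (forall i, i \in P -> i.+1 < n) ->
  exists2 mu, bounded_part c (n - c) mu & jump_perm n c mu @: firsts n c = P.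
Proof.
move=> cP cn hP; pose f := nth 0 [seq val i | i <- enum P].
have ss : sorted ltn [seq val i | i <- enum P] by rewrite sorted_map sorted_enum_ord.
have zs : size [seq val i | i <- enum P] = c by rewrite size_map -cardE.
(* [f k] is the [k]-th point of [P] from below, so [F i] is the displacement of the [i]-th point
   from above, both counted from 0. *)
pose F i := f (c - i.+1) - (c - i.+1).
pose mu0 := [seq F i | i <- iota 0 c].
have f_ge k : k < c -> k <= f k.
  by move=> kc; have := sorted_ltn_gap _ 0 k ss (leq0n _); rewrite zs => /(_ kc); rewrite -/f; lia.
have f_gap i j : i <= j -> j < c -> f i + (j - i) <= f j.
  by move=> ij jc; apply: sorted_ltn_gap; rewrite ?zs.
have smu0 : sorted geq mu0.
  rewrite sorted_map; apply: (@sub_in_sorted _ (gtn c) ltn) (iota_ltn_sorted 0 c).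
    move=> i j; rewrite !inE /F /= => ic jc ij.
    have := f_gap (c - j.+1) (c - i.+1); lia.
  by apply/allP => i; rewrite mem_iota.
have nmu i : i < c -> nth 0 [seq m <- mu0 | 0 < m] i = F i.
  by move=> ic; rewrite nth_filter_pos // (nth_map 0) ?size_iota // nth_iota.
have hb : bounded_part c (n - c) [seq m <- mu0 | 0 < m].
  apply/and3P; split.
  - rewrite /is_part sorted_filter ?mem_filter //; exact: geq_trans.
  - by rewrite (leq_trans (size_subseq (filter_subseq _ _))) // size_map size_iota.
  rewrite -nth0; case: (posnP c) => [c0|c0].
    by rewrite (_ : mu0 = [::]) /= ?subn_gt0 // /mu0 c0.
  rewrite nmu // /F.
  have : nth 0 [seq val i | i <- enum P] (c - 1) \in [seq val i | i <- enum P].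
    by rewrite mem_nth // zs; lia.
  case/mapP=> i; rewrite mem_enum => /hP hi; rewrite -/f => ->.
  by rewrite /=; lia.
exists [seq m <- mu0 | 0 < m] => //.
have [h _] := jump_permP n c _ hb.
apply/eqP; rewrite eqEcard card_imset ?card_firsts ?cP ?leqnn ?andbT; last 2 first.
- exact: ltnW.
- exact: perm_inj.
apply/subsetP => x /imsetP[k]; rewrite inE => kc xE.
have xf : x = f k :> nat.
  rewrite xE h // nmu; last lia.
  rewrite /F (_ : c - (c - k.+1).+1 = k); last lia.
  by rewrite subnKC // f_ge.
have : f k \in [seq val i | i <- enum P] by rewrite mem_nth // zs.
by case/mapP=> i; rewrite mem_enum => iP; rewrite -xf => /val_inj->.
Qed.

(** * Minimal permutations *)

(* The word (c, c-1, ..., 1, n, ..., c+1), with positions and values shifted to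
   start from 0. *)
Definition is_block {n} (c : nat) (pi : 'S_n) : Prop :=
  forall k : 'I_n, pi k = (if k < c then c - k.+1 else n + c - k.+1) :> nat.

Lemma ex_block (n c : nat) : c <= n -> exists pi : 'S_n, is_block c pi.
Proof.
move=> cn; pose f (k : nat) := if k < c then c - k.+1 else n + c - k.+1.
have fn (k : 'I_n) : f k < n by have := ltn_ord k; rewrite /f; case: (ltnP k c); lia.
have finj : injective (fun k : 'I_n => Ordinal (fn k)).
  move=> k l /(congr1 val); rewrite /= /f => e; apply: val_inj => /=; move: e.
  by have := ltn_ord k; have := ltn_ord l; case: (ltnP k c); case: (ltnP l c); lia.
by exists (perm finj) => k; rewrite permE.
Qed.

Lemma is_block_inj {n} (c : nat) (pi pi' : 'S_n) : is_block c pi -> is_block c pi' -> pi = pi'.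
Proof. by move=> h h'; apply/permP => k; apply: val_inj; rewrite /= h h'. Qed.

Lemma one_lineE {n} (sigma : 'S_n) (f : nat -> nat) :
  (forall k : 'I_n, sigma k = f k :> nat) -> one_line sigma = [seq (f k).+1 | k <- iota 0 n].
Proof.
move=> h; rewrite -val_enum_ord -map_comp.
by apply: eq_map => k; rewrite /= h.
Qed.

Lemma one_line_block {n} (c : nat) (pi : 'S_n) :
  c <= n -> is_block c pi -> one_line pi = rev (iota 1 c) ++ rev (iota c.+1 (n - c)).
Proof.
move=> cn hpi.
rewrite (one_lineE pi (fun k => if k < c then c - k.+1 else n + c - k.+1) hpi).
apply: (@eq_from_nth _ 0); rewrite size_map size_iota ?size_cat ?size_rev ?size_iota; first lia.
move=> i i_n; rewrite (nth_map 0) ?size_iota // nth_iota // nth_cat size_rev size_iota add0n.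
case: ltnP => ic; rewrite nth_rev ?size_iota ?nth_iota; lia.
Qed.

Lemma c1_block {n} (c : nat) (pi : 'S_n) : 0 < c <= n -> is_block c pi -> c1 pi = c.
Proof.
case/andP=> c0 cn hpi; rewrite /c1 (one_line_block c) //.
by case: c c0 {cn hpi} => // c _; rewrite -[c.+1]addn1 iotaD rev_cat /= add1n addn1.
Qed.

(** * The insertion tableau of two decreasing runs *)

(** For increasing lists with [lo] below [hi], this is the insertion tableau of [rev lo ++ rev hi];
    surplus letters of [hi] fall into the first column. *)
Fixpoint two_col_tab (lo hi : seq nat) : seq (seq nat) :=
  match lo, hi with
  | a :: lo', b :: hi' => [:: a; b] :: two_col_tab lo' hi'
  | [::], _ => [seq [:: b] | b <- hi]
  | _, [::] => [seq [:: a] | a <- lo]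
  end.

(** The letter [x] exceeds [lo] and bumps the first letter of [hi], which meets the same situation
    in the next row, so [hi] moves down by one place. *)
Lemma row_insert_two_col (lo hi : seq nat) (x : nat) :
  all (gtn x) lo -> path ltn x hi ->
  row_insert (two_col_tab lo hi) x = two_col_tab lo (x :: hi).
Proof.
elim: lo hi x => [|a lo IH] [|b hi] x //=.
- elim: hi b x => [|b' hi IH] b x _ /= /andP[xb h]; rewrite xb //=.
  by rewrite IH.
- by case/andP=> ax _ _; rewrite ltnNge ltnW //=; case: (lo).
- case/andP=> ax hlo /andP[xb h]; rewrite ltnNge ltnW //= xb /= IH //.
  by apply: sub_all hlo => y /= yx; apply: ltn_trans yx xb.
Qed.

Lemma foldl_row_insert_two_col (lo hi : seq nat) :
  sorted ltn hi -> allrel (fun a b => a < b) lo hi ->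
  foldl row_insert (two_col_tab lo [::]) (rev hi) = two_col_tab lo hi.
Proof.
elim: hi => [|x hi IH] //= sh; rewrite allrel_consr => /andP[h1 h2].
by rewrite rev_cons foldl_rcons IH ?(path_sorted sh) // row_insert_two_col.
Qed.

Lemma size_two_col (lo hi : seq nat) :
  [seq size row | row <- two_col_tab lo hi] =
    nseq (minn (size lo) (size hi)) 2 ++
    nseq (maxn (size lo) (size hi) - minn (size lo) (size hi)) 1.
Proof.
have single (l : seq nat) : [seq size row | row <- [seq [:: a] | a <- l]] = nseq (size l) 1.
  by elim: l => //= a l ->.
elim: lo hi => [|a lo IH] [|b hi] //=.
- by rewrite single.
- by rewrite single.
- by rewrite IH minnSS maxnSS subSS.
Qed.

(** The word consists of two decreasing runs, and the order of the lengths [s] and [r] affects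
    neither their minimum nor their maximum. *)
Lemma perm_shape_block {n} (c s r : nat) (pi : 'S_n) :
  n = s + r -> r <= s -> (c == s) || (c == r) -> is_block c pi ->
  perm_shape pi = nseq r 2 ++ nseq (s - r) 1.
Proof.
move=> nE rs hc hpi; have cn : c <= n by case/orP: hc => /eqP->; lia.
rewrite /perm_shape (one_line_block c) // /RS_shape foldl_cat.
have e0 : foldl row_insert [::] (rev (iota 1 c)) = two_col_tab (iota 1 c) [::].
  rewrite -[[::]]/(two_col_tab [::] [::]) foldl_row_insert_two_col ?iota_ltn_sorted //.
  by case: c {hc hpi cn}.
rewrite e0 foldl_row_insert_two_col ?iota_ltn_sorted //; last first.
  by apply/allrelP => a b; rewrite !mem_iota; lia.
rewrite size_two_col !size_iota; case/orP: hc => /eqP->.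
  by congr (nseq _ _ ++ nseq _ _); lia.
by congr (nseq _ _ ++ nseq _ _); lia.
Qed.

(** * Two-column shapes and minimal inversion number *)

Lemma two_column_partE (n s r : nat) (la : seq nat) :
  is_part_of n la -> conj_part la = [:: s; r] ->
  [/\ n = s + r, la = nseq r 2 ++ nseq (s - r) 1, size la = s & head 0 la = 2].
Proof.
case/andP=> /andP[sla z] /eqP <-; rewrite /conj_part.
(* The conjugate has [head 0 la] entries, so the largest part is 2. *)
have [h2|] := eqVneq (head 0 la) 2; last first.
  by move=> h /(congr1 size); rewrite size_map size_iota /= => e; rewrite e in h.
rewrite h2 /= => -[<- <-].
have le2 : all (geq 2) la.
  case: la sla z h2 => //= a la + _ e; rewrite e => sla.
  by apply: sub_all (order_path_min geq_trans sla) => ? /=.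
have sE : count (leq 1) la = size la.
  by apply/eqP; rewrite -all_count; apply/allP => -[] //; rewrite (negPf z).
have E : la = nseq (count (leq 2) la) 2 ++ nseq (size la - count (leq 2) la) 1.
  elim: la sla z le2 {h2 sE} => //= a la IH sla; rewrite inE negb_or eq_sym.
  case/andP=> a0 z /andP[a2 le2]; have E := IH (path_sorted sla) z le2.
  case: a a0 a2 sla => [|[|[|]]] //= _ _ sla; last by rewrite {1}E add1n subSS.
  have l1 : la = nseq (size la) 1.
    apply/all_pred1P/allP => y yl /=.
    have := allP (order_path_min geq_trans sla) y yl => /=.
    by case: y yl => [|[|]] //; rewrite (negPf z).
  by rewrite (_ : count _ la = 0) /= -?l1 // l1 count_nseq.
rewrite -[count [eta leq 1] la]/(count (leq 1) la) sE; split=> //.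
rewrite {1}E sumn_cat !sumn_nseq; move: (count_size (leq 2) la).
by set k := count _ _; rewrite -/k; lia.
Qed.

Lemma firstsC_card (n c : nat) : c <= n -> #|~: firsts n c| = n - c.
Proof. by move=> cn; have := cardsC (firsts n c); rewrite card_firsts // card_ord; lia. Qed.

Lemma rise_num_block {n} (c : nat) (pi : 'S_n) :
  c <= n -> is_block c pi -> rise_num pi = c * (n - c).
Proof.
move=> cn hpi; rewrite -(firstsC_card n c cn) -[X in X * _](card_firsts n c cn) -cardsX.
apply: eq_card => -[i j]; rewrite !inE /= /rise !hpi.
by have := ltn_ord i; have := ltn_ord j; case: (ltnP i c); case: (ltnP j c); lia.
Qed.

Lemma inv_num_rise {n} (sigma : 'S_n) :
  inv_num sigma + rise_num sigma = #|[set p : 'I_n * 'I_n | p.1 < p.2]|.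
Proof.
rewrite /inv_num /rise_num !card_set_sum -big_split; apply: eq_bigr => -[i j] _ /=.
rewrite /rise; case: (ltnP i j) => //= ij; case: ltngtP => // /val_inj/perm_inj e.
by rewrite e ltnn in ij.
Qed.

(** Inversions and rises add up to the number of pairs, and [r * s] is the largest number of rises
    for the shape, reached by a block permutation; so excess inversions are missing rises. *)
Lemma in_W {n} (s r Delta : nat) (la : seq nat) (sigma : 'S_n) :
  is_part_of n la -> conj_part la = [:: s; r] -> r <= s ->
  (sigma \in W n la Delta) =
    (perm_shape sigma == la) && (rise_num sigma + Delta == r * s).
Proof.
move=> hla hconj rs; rewrite inE; case: (boolP (perm_shape sigma == la)) => //= hs.
have [nE laE szla hdla] := two_column_partE _ _ _ _ hla hconj.
have ts (tau : 'S_n) : perm_shape tau == la -> two_column s tau.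
  by move/eqP=> e; rewrite /two_column e szla hdla.
have sn : s <= n by lia.
have [pi hpi] := ex_block n s sn.
have hpila : perm_shape pi == la.
  by rewrite laE (perm_shape_block s s r) // eqxx.
case: arg_minnP => // tau htau hmin.
have := hmin pi hpila; have := rise_num_le tau s r nE (ts _ htau).
have := rise_num_block s pi sn hpi; rewrite (_ : n - s = r); last lia.
have := inv_num_rise pi; have := inv_num_rise tau; have := inv_num_rise sigma.
by rewrite (mulnC s); move: (r * s) => rs'; lia.
Qed.

(** * Crossings between the two blocks and recovery of the jump *)

Lemma perm_imsetC {n} (g : 'S_n) (X : {set 'I_n}) : g @: (~: X) = ~: (g @: X).
Proof.
apply/setP => x; rewrite -{1 2}(permKV g x) !inE !mem_imset; try exact: perm_inj.
by rewrite inE.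
Qed.

Lemma cross_num_perm {n} (sigma : 'S_n) (P : {set 'I_n}) :
  cross_num (sigma @: P) =
    #|[set p : 'I_n * 'I_n | [&& p.1 \in P, p.2 \notin P & sigma p.2 < sigma p.1]]|.
Proof.
rewrite /cross_num -[RHS](card_imset (f := fun p : 'I_n * 'I_n => (sigma p.1, sigma p.2))).
  apply: eq_card => -[v w]; rewrite inE /=.
  apply/idP/imsetP => [|[[i j]]].
    case/and3P=> /imsetP[i iP ->] wP wv; exists (i, (sigma^-1)%g w); rewrite ?inE /= ?permKV ?iP //.
    by rewrite wv andbT; apply: contra wP => h; rewrite -(permKV sigma w) imset_f.
  by rewrite inE /= => h [-> ->]; rewrite !mem_imset //; apply: perm_inj.
by move=> [i j] [k l] /= [/perm_inj-> /perm_inj->].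
Qed.

(** A point of [P] and a point outside [P] form a rise or are out of order in position or in value.
    They are not out of order in both, for then the reversed pair would be a rise that starts
    outside [P]. *)
Lemma cross_num_rise {n} (sigma : 'S_n) (P : {set 'I_n}) :
  (forall i j, rise sigma i j -> (i \in P) && (j \notin P)) ->
  cross_num P + cross_num (sigma @: P) + rise_num sigma = #|P| * #|~: P|.
Proof.
move=> hP; rewrite cross_num_perm -cardsX /cross_num /rise_num.
have -> : setX P (~: P) = [set p | (p.1 \in P) && (p.2 \notin P)].
  by apply/setP => -[i j]; rewrite !inE.
rewrite !card_set_sum -!big_split; apply: eq_bigr => -[i j] _ /=.
have := hP i j; have := hP j i; rewrite /rise.
case: (boolP (i \in P)) => /= iP; case: (boolP (j \in P)) => /= jP; try lia.
have ij : i != j :> nat by apply: contraNneq jP => /val_inj <-.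
have sij : sigma i != sigma j :> nat.
  by apply: contraNneq jP => /val_inj/perm_inj <-.
by case: (ltngtP i j) ij => //=; case: (ltngtP (sigma i) (sigma j)) sij => //=; lia.
Qed.

Lemma is_block_imset {n} (c : nat) (pi : 'S_n) :
  c <= n -> is_block c pi -> pi @: firsts n c = firsts n c.
Proof.
move=> cn hpi; apply/eqP; rewrite eqEcard card_imset ?leqnn ?andbT; last exact: perm_inj.
apply/subsetP => x /imsetP[k]; rewrite !inE => kc ->; rewrite hpi kc; lia.
Qed.

Lemma jump_blockE {n} (c : nat) (pi : 'S_n) (J : seq nat * seq nat) (k : 'I_n) :
  0 < c <= n -> is_block c pi ->
  jump J pi (jump_perm n c J.1 k) = jump_perm n c J.2 (pi k).
Proof. by move=> hc hpi; rewrite jumpE (c1_block c) // !permM permK. Qed.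

Lemma jump_imset {n} (c : nat) (pi : 'S_n) (J : seq nat * seq nat) :
  0 < c <= n -> is_block c pi ->
  jump J pi @: (jump_perm n c J.1 @: firsts n c) = jump_perm n c J.2 @: firsts n c.
Proof.
move=> hc hpi; have /andP[_ cn] := hc.
rewrite -{2}(is_block_imset c pi cn hpi) -!imset_comp.
by apply: eq_imset => k; rewrite /= (jump_blockE c).
Qed.

(* The set of positions determines [mu], the set of values determines [nu], and
   the decreasing bijections between the two sets and between their complements
   are unique. *)
Lemma ex_jump {n} (sigma : 'S_n) (s r Delta : nat) :
  0 < s -> n = s + r -> two_column s sigma -> rise_num sigma + Delta = r * s ->
  Delta < r ->
  exists (c : nat) (pi : 'S_n) (J : seq nat * seq nat),
    [/\ (c == s) || (c == r), is_block c pi,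
        bounded_part c (n - c) J.1 && bounded_part c (n - c) J.2,
        jump_size J = Delta & sigma = jump J pi].
Proof.
move=> s0 nE ts eE Dr.
have [hc dl dC] := lower_structure sigma s r Delta s0 nE ts eE Dr.
set P := lower sigma in hc dl dC; set c := #|P| in hc.
have hcn : 0 < c < n by case/orP: hc => /eqP->; lia.
have /andP[c0 cn] := hcn.
have hc0n : 0 < c <= n by rewrite c0 ltnW.
have [pi hpi] := ex_block n c (ltnW cn).
have hr i j : rise sigma i j -> (i \in P) && (j \notin P).
  move=> ij; rewrite !inE; apply/andP; split; first by apply/existsP; exists j.
  by apply/existsP => -[k]; apply: (rise_chain _ _ _ _ (proj2 ts) ij).
have up i : i \in P -> exists2 j : 'I_n, i < j & sigma i < sigma j.
  by rewrite inE => /existsP[j /andP[]]; exists j.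
(* A point of [P] is exceeded in position and in value by another point, so neither [P] nor its
   image contains the last ordinal. *)
have [|mu hmu muE] := ex_jump_perm n c P erefl cn.
  by move=> i /up[j ij _]; apply: leq_ltn_trans ij _.
have [||nu hnu nuE] := ex_jump_perm n c (sigma @: P) _ cn.
- by rewrite card_imset //; apply: perm_inj.
- by move=> v /imsetP[i /up[j _ ij] ->]; apply: leq_ltn_trans ij _.
exists c, pi, (mu, nu); split=> //=; first by rewrite hmu hnu.
  have := cross_num_rise sigma P hr.
  rewrite -{1}muE -nuE !cross_num_jump_perm ?(ltnW cn) //.
  have -> : #|P| * #|~: P| = r * s.
    have := cardsC P; rewrite card_ord -/c; case/orP: hc => /eqP cE h.
      have -> : #|~: P| = r by lia.
      by rewrite cE mulnC.
    have -> : #|~: P| = s by lia.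
    by rewrite cE.
  by rewrite /jump_size /=; lia.
have [_ hg] := jump_permP n c mu hmu; have [_ hh] := jump_permP n c nu hnu.
set g := jump_perm n c mu in muE hg; set h := jump_perm n c nu in nuE hh.
have gl : {in firsts n c &, forall k l : 'I_n, k < l -> g k < g l} by apply: jump_perm_firsts_lt.
have hl : {in firsts n c &, forall k l : 'I_n, k < l -> h k < h l} by apply: jump_perm_firsts_lt.
have gtr : transitive (fun i j : 'I_n => j < i) by move=> ? ? ? /= h1 h2; apply: ltn_trans h2 h1.
have gir : irreflexive (fun i j : 'I_n => j < i) by move=> ?; apply: ltnn.
(* On the lower block both maps are decreasing with the same image; [E2] treats the upper block in
   the same way. *)
have E1 : {in firsts n c, (fun k => sigma (g k)) =1 (fun k => h (pi k))}.
  apply: (monotone_imset_inj _ _ _ _ gtr gir).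
  - move=> k l kc lc kl; apply: (riseless_lt _ _ dl); rewrite -?muE ?imset_f //; exact: gl.
  - move=> k l; rewrite !inE => kc lc kl; apply: hl; rewrite ?inE !hpi ?kc ?lc; lia.
  - rewrite (imset_comp sigma g) muE (imset_comp h pi) (is_block_imset c) ?(ltnW cn) //.
have E2 : {in ~: firsts n c, (fun k => sigma (g k)) =1 (fun k => h (pi k))}.
  apply: (monotone_imset_inj _ _ _ _ gtr gir).
  - move=> k l kc lc kl; apply: (riseless_lt _ _ dC).
    + by rewrite -muE -perm_imsetC imset_f.
    + by rewrite -muE -perm_imsetC imset_f.
    + by apply: hg => //; move: kc; rewrite !inE -leqNgt.
  - move=> k l; rewrite !inE -!leqNgt => kc lc kl; have ln := ltn_ord l.
    by apply: hh; rewrite !hpi !ltnNge ?kc ?lc /=; lia.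
  - rewrite (imset_comp sigma g) perm_imsetC muE (imset_comp h pi) (perm_imsetC pi).
    by rewrite (is_block_imset c) ?(ltnW cn) // !perm_imsetC nuE.
apply/permP => x; rewrite -(permKV g x) (jump_blockE c pi (mu, nu)) //=.
set k := (g^-1)%g x; case: (boolP (k \in firsts n c)) => kc; first exact: E1.
by apply: E2; rewrite inE.
Qed.

(* An element of the lower block in no rise would cross all the [n - c] elements
   of the upper block, but there are only [jump_size J] crossings; the converse
   is symmetric. *)
Lemma jump_lower {n} (c : nat) (pi : 'S_n) (J : seq nat * seq nat) :
  0 < c <= n -> is_block c pi ->
  bounded_part c (n - c) J.1 -> bounded_part c (n - c) J.2 ->
  jump_size J < c -> jump_size J < n - c ->
  head 0 (perm_shape (jump J pi)) <= 2 ->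
  jump_perm n c J.1 @: firsts n c = lower (jump J pi).
Proof.
move=> hc hpi hmu hnu Jc Jnc h2; have /andP[_ cn] := hc.
have := jump_imset c pi J hc hpi.
set sigma := jump J pi; set P := _ @: firsts n c => sP.
have cP : #|P| = c by rewrite card_imset ?card_firsts //; apply: perm_inj.
have cC : #|~: P| = n - c by have := cardsC P; rewrite cP card_ord; lia.
have x1 : cross_num P = sumn J.1 by rewrite cross_num_jump_perm.
have x2 := cross_num_perm sigma P; rewrite sP cross_num_jump_perm // in x2.
have up i : i \in P -> exists2 j, j \notin P & rise sigma i j.
  move=> iP; apply/exists_inP; apply: contraTT Jnc => /exists_inPn nr.
  rewrite -leqNgt -cC /jump_size -x1 x2.
  (* Without a rise from [i], each of the [n - c] points outside [P] precedes [i] or has a smaller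
     value; pairing these points with [i] gives crossings. *)
  have : ~: P \subset [set j | (j \notin P) && (j < i)] :|:
                       [set j | (j \notin P) && (sigma j < sigma i)].
    apply/subsetP => j; rewrite !inE => jP; rewrite jP /=; have := nr j jP.
    rewrite /rise negb_and -!leqNgt.
    have ij : j != i by apply: contraNneq jP => ->.
    by case/orP; rewrite leq_eqVlt (inj_eq val_inj) ?(inj_eq perm_inj) (negPf ij) /= => ->; rewrite ?orbT.
  move/subset_leq_card/leq_trans; apply.
  apply: leq_trans (leq_card_setU _ _) (leq_add _ _).
    rewrite -(card_imset (f := pair i)); last by move=> ? ? [].
    by apply/subset_leq_card/subsetP => p /imsetP[j]; rewrite !inE => ? -> /=; rewrite iP.
  rewrite -(card_imset (f := pair i)); last by move=> ? ? [].
  by apply/subset_leq_card/subsetP => p /imsetP[j]; rewrite !inE => ? -> /=; rewrite iP.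
have dn j : j \notin P -> exists2 i, i \in P & rise sigma i j.
  move=> jP; apply/exists_inP; apply: contraTT Jc => /exists_inPn nr.
  rewrite -leqNgt -cP /jump_size -x1 x2.
  have : P \subset [set i | (i \in P) && (j < i)] :|:
                    [set i | (i \in P) && (sigma j < sigma i)].
    apply/subsetP => i iP; rewrite !inE iP /=; have := nr i iP.
    rewrite /rise negb_and -!leqNgt.
    have ij : j != i by apply: contraNneq jP => ->.
    by case/orP; rewrite leq_eqVlt (inj_eq val_inj) ?(inj_eq perm_inj) (negPf ij) /= => ->; rewrite ?orbT.
  move/subset_leq_card/leq_trans; apply.
  apply: leq_trans (leq_card_setU _ _) (leq_add _ _).
    rewrite -(card_imset (f := fun i => (i, j))); last by move=> ? ? [].
    by apply/subset_leq_card/subsetP => p /imsetP[i]; rewrite !inE => /andP[? ?] -> /=; apply/and3P.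
  rewrite -(card_imset (f := fun i => (i, j))); last by move=> ? ? [].
  by apply/subset_leq_card/subsetP => p /imsetP[i]; rewrite !inE => /andP[? ?] -> /=; apply/and3P.
apply/setP => i; rewrite inE; apply/idP/existsP => [/up[j _]|[j ij]]; first by exists j.
(* A point outside [P] is the upper end of a rise, so it cannot be the lower end of another. *)
apply: contraT => /dn[k _ ki]; case: (rise_chain _ _ _ _ h2 ki ij).
Qed.

(** The lower block depends on the permutation alone. Its size gives [c] and hence the block
    permutation, and its sets of positions and values give the two partitions. *)
Lemma block_jump_inj {n} (c c' : nat) (pi pi' : 'S_n) (J J' : seq nat * seq nat) :
  0 < c <= n -> 0 < c' <= n -> is_block c pi -> is_block c' pi' ->
  bounded_part c (n - c) J.1 -> bounded_part c (n - c) J.2 ->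
  bounded_part c' (n - c') J'.1 -> bounded_part c' (n - c') J'.2 ->
  jump_size J < minn c (n - c) -> jump_size J' < minn c' (n - c') ->
  head 0 (perm_shape (jump J pi)) <= 2 ->
  jump J pi = jump J' pi' -> (pi, J) = (pi', J').
Proof.
move=> hc hc' hpi hpi' b1 b2 b1' b2'; rewrite !leq_min => /andP[z1 z2] /andP[z1' z2'] h2 e.
have l := jump_lower c pi J hc hpi b1 b2 z1 z2 h2.
rewrite e in h2.
have l' := jump_lower c' pi' J' hc' hpi' b1' b2' z1' z2' h2.
have /andP[_ cn] := hc; have /andP[_ cn'] := hc'.
have i := jump_imset c pi J hc hpi; have i' := jump_imset c' pi' J' hc' hpi'.
have ce : c = c'.
  have : #|jump_perm n c J.1 @: firsts n c| = #|jump_perm n c' J'.1 @: firsts n c'|.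
    by rewrite l l' e.
  by rewrite !card_imset ?card_firsts //; apply: perm_inj.
case: _ / ce in hc' hpi' b1' b2' z1' z2' l' cn' i' *.
have m1 : J.1 = J'.1 by apply: (jump_perm_imset_inj n c) => //; rewrite l l' e.
have m2 : J.2 = J'.2.
  by apply: (jump_perm_imset_inj n c) => //; rewrite -i -i' l l' e.
rewrite (is_block_inj c pi pi' hpi hpi').
by case: J J' m1 m2 {b1 b2 b1' b2' z1 z2 z1' z2' h2 e l l' i i'} => ? ? [? ?] /= -> ->.
Qed.

Theorem theorem22 (n s r Delta : nat) (la : seq nat) (sigma : 'S_n)
    (hla : is_part_of n la) (hconj : conj_part la = [:: s; r])
    (hrs : r <= s) (hr : 1 <= r) (hDelta : Delta < r)
    (hsigma : sigma \in W n la Delta) :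
  exists! piJ : 'S_n * (seq nat * seq nat),
    [/\ piJ.1 \in W n la 0,
        jump_part piJ.1 piJ.2,
        jump_size piJ.2 = Delta,
        valid_jump piJ.2 piJ.1
      & sigma = jump piJ.2 piJ.1].
Proof.
have [nE laE szla hdla] := two_column_partE _ _ _ _ hla hconj.
have ts (tau : 'S_n) : perm_shape tau = la -> two_column s tau.
  by move=> e; rewrite /two_column e szla hdla.
have s0 : 0 < s by lia.
have inW D := in_W s r D la _ hla hconj hrs.
move: (hsigma); rewrite inW => /andP[/eqP shs /eqP es].
(* [c] and [n - c] are [r] and [s] in some order, so both exceed [Delta]. *)
have cle c : (c == s) || (c == r) -> [/\ 0 < c <= n, Delta < minn c (n - c) & c * (n - c) = r * s].
  case/orP=> /eqP->; rewrite nE leq_min; first by rewrite addKn mulnC; split; lia.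
  by rewrite addnK; split; lia.
have [c [pi [J [hc hpi /andP[b1 b2] zJ sE]]]] := ex_jump sigma s r Delta s0 nE (ts _ shs) es hDelta.
have [hcn Dc cr] := cle c hc; have /andP[_ cn] := hcn.
have pila : perm_shape pi = la by rewrite laE (perm_shape_block c s r).
exists (pi, J); split.
  split=> //=.
  - by rewrite inW pila eqxx /= (rise_num_block c) // cr addn0.
  - by rewrite /jump_part /c2 (c1_block c) // b1 b2.
  - by rewrite /valid_jump -sE shs pila.
case=> pi' J' [] /=; rewrite inW => /andP[/eqP sh' /eqP e'] /andP[b1' b2'] zJ' _ sE'.
(* The existence result with no missing rise shows that a minimal permutation is a block: the jump
   that it provides has size 0. *)
have [c' [rho [K [hc' hrho /andP[k1 k2] zK piE]]]] := ex_jump pi' s r 0 s0 nE (ts _ sh') e' hr.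
have nil0 mu : bounded_part c' (n - c') mu -> sumn mu = 0 -> mu = [::].
  case/and3P=> /andP[_ zmu] _ _; case: mu zmu => //= a mu.
  by rewrite inE negb_or eq_sym => /andP[a0 _]; case: a a0.
have {K zK k1 k2}piE : pi' = rho.
  rewrite piE; case: K zK k1 k2 {piE} => K1 K2 /= zK k1 k2.
  have [z1 z2] : sumn K1 = 0 /\ sumn K2 = 0 by move: zK; rewrite /jump_size /=; lia.
  rewrite (nil0 K1 k1 z1) (nil0 K2 k2 z2) jumpE /jump_perm /adj_prod /= !big_nil.
  by rewrite invg1 mul1g mulg1.
rewrite piE in b1' b2' sE' *; clear pi' sh' e' piE.
have [hcn' Dc' _] := cle c' hc'.
rewrite /c2 (c1_block c') // in b1' b2'.
apply: (block_jump_inj c c') => //; rewrite ?zJ ?zJ' //.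
- by rewrite -sE shs hdla.
- by rewrite -sE.
Qed.
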